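(* Let $N\ge2$ and $\alpha\in\triangle_N$. For any positive integers $m,k$ with $m\ge 2$, $$|I_m-I_{m;k}|\le\frac{e\,m\sqrt{m-1}}{N^k}.$$
   Context: $\triangle_N$ is the set of $\alpha=(\alpha_0,\dots,\alpha_{N-1})\in\mathbb{R}^N$ with all $\alpha_n\ge 0$ and $\sum_n\alpha_n=1$. For $\alpha\in\triangle_N$ (with $N\ge2$), the $\alpha$-weighted Cantor measure $\mu^\alpha$ is the unique Borel probability measure on $\mathbb{R}$ supported in $[0,1]$ satisfying $\mu^\alpha(E)=\sum_{n=0}^{N-1}\alpha_n\mu^\alpha(\varphi_n^{-1}(E))$ for all Borel sets $E$, where $\varphi_n(x)=(x+n)/N$. Its $m$-th moment is $I_m=\int_0^1x^m\,d\mu^\alpha(x)$. For each nonnegative integer $k$, the numbers $I_{m;k}$ ($m\ge0$) are defined by the power series expansion $$\prod_{r=1}^k\sum_{n=0}^{N-1}\alpha_n\exp\left(\frac{nz}{N^r}\right)=\sum_{m=0}^\infty I_{m;k}\frac{z^m}{m!},\qquad z\in\mathbb{C}.$$ *)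

(* Defs.v *)
From HB Require Import structures.
From mathcomp Require Import all_boot all_order all_algebra.
From mathcomp Require Import complex.
From mathcomp Require Import all_classical all_reals all_analysis.

Set Implicit Arguments.
Unset Strict Implicit.
Unset Printing Implicit Defensive.
Import Order.TTheory GRing.Theory Num.Theory.
Import numFieldNormedType.Exports.
Local Open Scope classical_set_scope.
Local Open Scope ring_scope.
Local Open Scope complex_scope.

Definition simplex (R : realType) (N : nat) : set 'rV[R]_N :=
  [set alpha | (forall n, 0 <= alpha 0 n) /\ \sum_n alpha 0 n = 1].

Definition phi (R : realType) (N : nat) (n : 'I_N) (x : R) : R :=
  (x + n%:R) / N%:R.

(* Being supported in the closed set [0, 1] means that its complement is a
   null set. *)
Definition weighted_cantor_measure (R : realType) (N : nat)
    (alpha : 'rV[R]_N) (mu : probability (measurableTypeR R) R) : Prop :=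
  mu (~` `[0, 1]) = 0%E /\
  forall E : set (measurableTypeR R), measurable E ->
    mu E = (\sum_(n < N) (alpha 0 n)%:E * mu (phi n @^-1` E))%E.

Definition moment (R : realType) (mu : probability (measurableTypeR R) R)
    (m : nat) : R :=
  \int[mu]_(x in `[0, 1]) (x ^+ m).

Definition cexp (R : realType) (z : R[i]) : R[i] :=
  (expR (complex.Re z))%:C * (cos (complex.Im z) +i* sin (complex.Im z)).

(* The coefficients [I m k] are complex a priori: they are determined only by
   the expansion, which is required to converge at every complex [z].  The
   ascription [R[i]^o] selects the topology of the complex modulus. *)
Definition approximate_moments (R : realType) (N : nat) (alpha : 'rV[R]_N)
    (I : nat -> nat -> R[i]) : Prop :=
  forall (k : nat) (z : R[i]),
    series (fun m => I m k * z ^+ m / m`!%:R) @ \oo -->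
    (\prod_(1 <= r < k.+1)
       \sum_(n < N) (alpha 0 n)%:C * cexp (n%:R * z / N%:R ^+ r) : R[i]^o).

(* Main.v *)
(* Let [T g x = sum_n alpha_n g ((x + n) / N)].  Self-similarity of [mu] says
   that [mu] integrates [g] and [T g] alike, so [I_m] is the integral of
   [T^k x^m].  On the other hand [T^k exp(t x)] at [x = 0] is the product
   defining the generating function, so [I_{m;k}] is the value of [T^k x^m] at
   [0]; to compare coefficients it is enough to let [z] be real.  Each
   application of [T] divides Lipschitz constants on [[0, 1]] by [N], and [x^m]
   is nondecreasing and [m]-Lipschitz there, whence
   [0 <= I_m - I_{m;k} <= m / N^k].  This is stronger than the claim, since
   [e * sqrt (m - 1) >= 1]. *)
Require Import Defs.
From HB Require Import structures.
From mathcomp Require Import all_boot all_order all_algebra.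
From mathcomp Require Import complex ring lra.
From mathcomp Require Import all_classical all_reals all_analysis.
From mathcomp Require Import measurable_realfun.
Import Order.TTheory GRing.Theory Num.Theory.
Import numFieldNormedType.Exports.
Local Open Scope classical_set_scope.
Local Open Scope ring_scope.
Local Open Scope complex_scope.

(** * Uniqueness of the coefficients of a real power series *)

Lemma power_series_coef0 (R : realType) (c : nat -> R) :
  (forall t : R, t != 0 -> series (fun n => c n * t ^+ n) @ \oo --> (0 : R)) ->
  c 0%N = 0.
Proof.
move=> hc.
(* Convergence at [t = 1] forces [c n] to tend to 0, hence to be bounded. *)
have [C [C0 hC]] : exists C : R, 0 < C /\ forall n, `|c n| <= C.
  have h1 : series c @ \oo --> (0 : R).
    have := hc 1 (oner_neq0 _).
    by under eq_fun do rewrite expr1n mulr1.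
  have /cvg_series_cvg_0 cc : cvgn (series c) by apply/cvg_ex; exists 0.
  have : cvgn c by apply/cvg_ex; exists 0.
  move=> /cvg_seq_bounded /pinfty_ex_gt0 [C C0 hC].
  by exists C; split=> // n; exact: hC.
have small (t : R) : 0 < t -> t <= 2^-1 -> `|c 0%N| <= 2 * C * t.
  move=> t0 t2.
  (* As [t <= 1/2], the terms after [c 0] are dominated by [C * t] times a geometric series of ratio
     1/2; the factor [1 - 2^-1 ^+ n] records its partial sums, so that the induction closes. *)
  have tail n : `|series (fun n => c n * t ^+ n) n.+1 - c 0%N| <=
      2 * C * t * (1 - 2^-1 ^+ n).
    elim: n => [|n IHn].
      by rewrite seriesEord /= big_ord1 expr0 mulr1 !subrr normr0 mulr0.
    have -> : series (fun n => c n * t ^+ n) n.+2 =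
        series (fun n => c n * t ^+ n) n.+1 + c n.+1 * t ^+ n.+1.
      by rewrite !seriesEord /= [LHS]big_ord_recr.
    rewrite addrAC; apply: (le_trans (ler_normD _ _)).
    have step : `|c n.+1 * t ^+ n.+1| <= C * t * 2^-1 ^+ n.
      rewrite normrM normrX (gtr0_norm t0) exprS -mulrA.
      apply: ler_pM => //; first by rewrite mulr_ge0 ?exprn_ge0 // ltW.
      by rewrite ler_wpM2l ?(ltW t0)// lerXn2r // nnegrE ltW.
    apply: (le_trans (lerD IHn step)).
    by rewrite exprS; lra.
  have lim : (fun n => series (fun n => c n * t ^+ n) n.+1 - c 0%N) @ \oo
      --> 0 - c 0%N.
    apply: cvgB; last exact: cvg_cst.
    have := hc t (lt0r_neq0 t0).
    by rewrite -(cvg_shiftS (series _)).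
  rewrite -normrN -[X in `|X|]sub0r.
  apply: (ler_cvg_to (cvg_norm lim) (cvg_cst (2 * C * t))).
  apply: nearW => n; apply: (le_trans (tail n)).
  by rewrite ler_piMr ?mulr_ge0 ?(ltW t0) ?(ltW C0)// gerBl exprn_ge0.
apply/eqP; rewrite -normr_eq0 eq_le normr_ge0 andbT.
apply/ler_addgt0Pr => e e0; rewrite add0r.
have C2 : 0 < 2 * C by rewrite mulr_gt0.
(* Take [t = e / (2 * C)] when [small] allows it; otherwise [t = 1/2] gives [C], which is then at
   most [e]. *)
have [le2|/ltW le2] := leP (e / (2 * C)) 2^-1.
  have := small (e / (2 * C)) (divr_gt0 e0 C2) le2.
  by rewrite mulrC divfK // gt_eqF.
apply: (le_trans (small 2^-1 _ (lexx _))); first by rewrite invr_gt0.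
by rewrite mulrC -ler_pdivlMr.
Qed.

Lemma power_series_eq0 (R : realType) (c : nat -> R) :
  (forall t : R, series (fun n => c n * t ^+ n) @ \oo --> (0 : R)) ->
  forall n, c n = 0.
Proof.
move=> hc n.
(* Removing [c 0 = 0] and dividing by [t] shifts the coefficients, but only for [t != 0]. The
   hypothesis is weakened accordingly before the induction. *)
have {}hc (t : R) (_ : t != 0) := hc t.
elim: n c hc => [|n IHn] c hc; first exact: power_series_coef0 hc.
apply: (IHn (fun i => c i.+1)) => t t0.
have c0 := power_series_coef0 _ _ hc.
have -> : (series (fun i => c i.+1 * t ^+ i) : nat -> R) =
    (fun i => t^-1 * series (fun i => c i * t ^+ i) i.+1).
  apply/funext => i; rewrite !seriesEord /= big_ord_recl /= c0 mul0r add0r.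
  rewrite mulr_sumr; apply: eq_bigr => j _.
  by rewrite /bump /= add1n exprS mulrCA mulKf.
rewrite -[0 in X in _ --> X](mulr0 t^-1).
apply: cvgM; first exact: cvg_cst.
by rewrite (cvg_shiftS (series _)); exact: hc.
Qed.

Lemma power_series_coef_unique (R : realType) (a b : nat -> R) (f : R -> R) :
  (forall t : R, series (fun n => a n * t ^+ n) @ \oo --> f t) ->
  (forall t : R, series (fun n => b n * t ^+ n) @ \oo --> f t) ->
  forall n, a n = b n.
Proof.
move=> ha hb n; apply/eqP; rewrite -subr_eq0; apply/eqP.
apply: (power_series_eq0 _ (fun n => a n - b n)) => t.
rewrite -(subrr (f t)).
have -> : series (fun n => (a n - b n) * t ^+ n) =
    (fun n => series (fun n => a n * t ^+ n) n - series (fun n => b n * t ^+ n) n).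
  apply/funext => i; rewrite !seriesEord /= -sumrB.
  by apply: eq_bigr => j _; rewrite mulrBl.
exact: cvgB.
Qed.

(** * The transfer operator and its iterates *)

Definition transfer {R : realType} {N : nat} (alpha : 'rV[R]_N)
    (g : R -> R) (x : R) : R :=
  \sum_(n < N) alpha 0 n * g (phi n x).

Section Transfer.
Variables (R : realType) (N : nat) (alpha : 'rV[R]_N).
Hypotheses (N0 : (0 < N)%N) (halpha : simplex alpha).
Let T := transfer alpha.

Lemma phi_ge0 (n : 'I_N) (x : R) : 0 <= x -> 0 <= phi n x.
Proof. by move=> x0; rewrite /phi divr_ge0 ?addr_ge0. Qed.

Lemma phi_le1 (n : 'I_N) (x : R) : x <= 1 -> phi n x <= 1.
Proof.
move=> x1; rewrite /phi ler_pdivrMr ?ltr0n // mul1r.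
by rewrite (le_trans (lerD x1 (lexx _)))// nat1r ler_nat.
Qed.

Lemma transfer_ge0 (g : R -> R) :
  (forall x, 0 <= g x) -> forall x, 0 <= T g x.
Proof.
by move=> g0 x; apply: sumr_ge0 => n _; rewrite mulr_ge0 // (halpha.1 n).
Qed.

(** Each [phi n] is increasing, maps [0, 1] into itself and divides distances by [N]; averaging with
    nonnegative weights of sum 1 preserves both bounds. *)
Lemma iter_transfer_lipschitz (g : R -> R) (L : R) (k : nat) :
  (forall x y : R, 0 <= x -> x <= y -> y <= 1 -> 0 <= g y - g x <= L * (y - x)) ->
  forall x y : R, 0 <= x -> x <= y -> y <= 1 ->
    0 <= iter k T g y - iter k T g x <= L / N%:R ^+ k * (y - x).
Proof.
move=> hg; elim: k => [|k IHk] x y x0 xy y1; first by rewrite expr0 divr1 hg.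
set h := iter k T g in IHk *.
have hn (n : 'I_N) : 0 <= h (phi n y) - h (phi n x) <= L / N%:R ^+ k.+1 * (y - x).
  have -> : L / N%:R ^+ k.+1 * (y - x) =
      L / N%:R ^+ k * (phi n y - phi n x).
    have -> : phi n y - phi n x = (y - x) / N%:R by rewrite /phi; ring.
    by rewrite exprS invfM; ring.
  apply: IHk; [exact: phi_ge0 | | exact: phi_le1].
  by rewrite /phi ler_pM2r ?invr_gt0 ?ltr0n // lerD2r.
rewrite iterS -/h /T /transfer -sumrB; apply/andP; split.
  apply: sumr_ge0 => n _; rewrite -mulrBr mulr_ge0 ?(halpha.1 n)//.
  by have /andP[] := hn n.
rewrite -[leRHS]mul1r -{1}halpha.2 mulr_suml.
apply: ler_sum => n _; rewrite -mulrBr ler_wpM2l ?(halpha.1 n)//.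
by have /andP[] := hn n.
Qed.

Lemma eq_transfer (f g : R -> R) : f =1 g -> T f =1 T g.
Proof. by move=> fg x; apply: eq_bigr => n _; rewrite fg. Qed.

Lemma transferZ (a : R) (g : R -> R) (x : R) :
  T (fun y => a * g y) x = a * T g x.
Proof.
by rewrite /T /transfer mulr_sumr; apply: eq_bigr => n _; rewrite mulrCA.
Qed.

Lemma iter_transferZ (k : nat) (a : R) (g : R -> R) (x : R) :
  iter k T (fun y => a * g y) x = a * iter k T g x.
Proof.
elim: k x => [//|k IHk] x.
by rewrite !iterS (eq_transfer _ _ IHk) transferZ.
Qed.

(** At [x >= 0] only points [phi n x >= 0] are sampled. This later allows [|x| ^+ m] in place of
    [x ^+ m]. *)
Lemma eq_iter_transfer_ge0 (k : nat) (f g : R -> R) :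
  (forall x, 0 <= x -> f x = g x) ->
  forall x, 0 <= x -> iter k T f x = iter k T g x.
Proof.
move=> fg; elim: k => [//|k IHk] x x0.
by rewrite !iterS; apply: eq_bigr => n _; rewrite IHk // phi_ge0.
Qed.

(** Exponentials are mapped to multiples of exponentials: composing with [phi n] divides the
    frequency by [N] and splits off a constant, and these constants average to the next factor of
    the product. *)
Lemma iter_transfer_exp (k : nat) (t x : R) :
  iter k T (fun y => expR (t * y)) x =
  expR (t / N%:R ^+ k * x) *
    \prod_(1 <= r < k.+1) \sum_(n < N) alpha 0 n * expR (n%:R * t / N%:R ^+ r).
Proof.
elim: k x => [|k IHk] x; first by rewrite /= big_geq // mulr1 expr0 divr1.
rewrite iterS (eq_transfer _ _ IHk) [in RHS]big_nat_recr //= /T /transfer.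
rewrite [RHS]mulrA !mulr_sumr; apply: eq_bigr => n _.
have -> : t / N%:R ^+ k * phi n x =
    t / N%:R ^+ k.+1 * x + n%:R * t / N%:R ^+ k.+1.
  by rewrite /phi exprSr invfM; ring.
by rewrite expRD; ring.
Qed.

(** Pointwise convergence suffices, because each application of [T] is a finite combination of point
    values. *)
Lemma cvg_series_iter_transfer (k : nat) (g : nat -> R -> R) (h : R -> R) :
  (forall x, series (g ^~ x) @ \oo --> h x) ->
  forall x, series (fun m => iter k T (g m) x) @ \oo --> iter k T h x.
Proof.
move=> gh; elim: k => [//|k IHk] x; rewrite iterS {2}/T /transfer.
have -> : series (fun m => iter k.+1 T (g m) x) =
    (fun i => \sum_(n < N) alpha 0 n *
       series (fun m => iter k T (g m) (phi n x)) i).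
  apply/funext => i; rewrite seriesEord /= exchange_big /=.
  by apply: eq_bigr => n _; rewrite seriesEord /= mulr_sumr.
apply: cvg_big => [|n _]; first by move=> *; exact: add_continuous.
by apply: cvgM; [exact: cvg_cst | exact: IHk].
Qed.

Lemma exp_moment_series (k : nat) (t : R) :
  series (fun m => iter k T (fun x => x ^+ m) 0 / m`!%:R * t ^+ m) @ \oo -->
  \prod_(1 <= r < k.+1) \sum_(n < N) alpha 0 n * expR (n%:R * t / N%:R ^+ r).
Proof.
have -> : \prod_(1 <= r < k.+1)
    \sum_(n < N) alpha 0 n * expR (n%:R * t / N%:R ^+ r) =
    iter k T (fun y => expR (t * y)) 0.
  by rewrite iter_transfer_exp mulr0 expR0 mul1r.
(* By linearity the m-th term is the image of the m-th term of the expansion of [expR (t * x)]. *)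
have -> : series (fun m => iter k T (fun x => x ^+ m) 0 / m`!%:R * t ^+ m) =
    series (fun m => iter k T (fun x => exp_coeff (t * x) m) 0).
  congr series; apply/funext => m.
  have -> : (fun x => exp_coeff (t * x) m) =
      (fun x : R => t ^+ m / m`!%:R * x ^+ m).
    by apply/funext => x; rewrite /exp_coeff /= exprMn; ring.
  by rewrite iter_transferZ; ring.
apply: (cvg_series_iter_transfer k (fun m x => exp_coeff (t * x) m)) => x.
exact: is_cvg_series_exp_coeff.
Qed.


(** * Integration against the self-similar measure *)

Lemma measurable_phi (n : 'I_N) :
  measurable_fun [set: measurableTypeR R]
    (phi n : measurableTypeR R -> measurableTypeR R).
Proof.
rewrite /phi; apply: measurable_funM; last exact: measurable_cst.
by apply: measurable_funD; [exact: measurable_id | exact: measurable_cst].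
Qed.

Lemma measurable_transfer (g : R -> R) :
  measurable_fun [set: R] g -> measurable_fun [set: R] (T g).
Proof.
move=> mg; apply: measurable_sum => n.
apply: measurable_funM; first exact: measurable_cst.
exact: measurableT_comp mg (measurable_phi n).
Qed.

Section Invariance.
Variables (mu : probability (measurableTypeR R) R).
Hypothesis hmu : weighted_cantor_measure alpha mu.

Let weight (n : 'I_N) : {nonneg R} := NngNum (halpha.1 n).

Let image_measure (n : 'I_N) : {measure set (measurableTypeR R) -> \bar R}.
Proof.
refine (pushforward mu (phi n : measurableTypeR R -> measurableTypeR R)).
exact: measurable_phi.
Defined.

(** [msum] takes a family indexed by [nat], so the weighted image measures are extended by the zero
    measure beyond [N]. *)
Let component (i : nat) : {measure set (measurableTypeR R) -> \bar R} :=
  match insub i : option 'I_N with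
  | Some n => mscale (weight n) (image_measure n)
  | None => mzero
  end.

Lemma integral_transfer (g : R -> R) :
  measurable_fun [set: R] g -> (forall x, 0 <= g x) ->
  (\int[mu]_x (g x)%:E = \int[mu]_x (T g x)%:E)%E.
Proof.
move=> mg g0.
have mgE : measurable_fun [set: measurableTypeR R] (EFin \o g).
  exact/measurable_EFinP.
(* Self-similarity: [mu] agrees on measurable sets with the sum of its weighted images under the
   [phi n]. Change of variables in each image then produces [T g]. *)
rewrite (eq_measure_integral (msum component N)); last first.
  move=> E mE _; apply: (eq_trans (hmu.2 _ mE)).
  by apply: eq_bigr => n _; rewrite /component valK.
rewrite ge0_integral_measure_sum //; last by move=> x _; rewrite lee_fin.
under [RHS]eq_integral do rewrite /T /transfer -sumEFin.
rewrite ge0_integral_sum //; last 2 first.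
- move=> n; apply/measurable_EFinP; apply: measurable_funM => //.
  exact: measurableT_comp mg (measurable_phi n).
- by move=> n x _; rewrite lee_fin mulr_ge0 // (halpha.1 n).
apply: eq_bigr => n _; rewrite /component valK.
rewrite ge0_integral_mscale //; last by move=> x _; rewrite lee_fin.
rewrite (ge0_integral_pushforward (measurable_phi n)) //; last first.
  by move=> x _; rewrite lee_fin.
under [RHS]eq_integral do rewrite EFinM.
rewrite ge0_integralZl_EFin //; last 3 first.
- by move=> x _; rewrite lee_fin.
- by apply/measurable_EFinP; exact: measurableT_comp mg (measurable_phi n).
- exact: halpha.1.
Qed.

Lemma integral_iter_transfer (k : nat) (g : R -> R) :
  measurable_fun [set: R] g -> (forall x, 0 <= g x) ->
  (\int[mu]_x (g x)%:E = \int[mu]_x (iter k T g x)%:E)%E.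
Proof.
elim: k g => [//|k IHk] g mg g0; rewrite iterSr integral_transfer //.
by apply: IHk; [exact: measurable_transfer | exact: transfer_ge0].
Qed.

Lemma integral_unit_interval (g : R -> R) :
  measurable_fun [set: R] g -> (forall x, 0 <= g x) ->
  (\int[mu]_x (g x)%:E = \int[mu]_(x in `[0%R, 1%R]) (g x)%:E)%E.
Proof.
move=> mg g0; rewrite (ge0_negligible_integral
  (N := ~` `[0, 1] : set (measurableTypeR R))) //.
- by rewrite setTD setCK.
- by apply: measurableC; exact: measurable_itv.
- exact/measurable_EFinP.
- by move=> x _; rewrite lee_fin.
- exact: hmu.1.
Qed.

Lemma measure_unit_interval : mu (`[0, 1]%classic : set (measurableTypeR R)) = 1%E.
Proof.
rewrite -[`[0, 1]%classic]setCK probability_setC ?hmu.1 ?sube0 //.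
by apply: measurableC; exact: measurable_itv.
Qed.

Lemma moment_bounds (m k : nat) :
  let J := iter k T (fun x => x ^+ m) 0 in
  J <= moment mu m <= J + m%:R / N%:R ^+ k.
Proof.
set J := iter _ _ _ _ => /=.
(* Nonnegativity on the whole line lets the integrals be manipulated without
   integrability conditions. *)
pose p (x : R) := `|x| ^+ m.
have p0 x : 0 <= p x by rewrite exprn_ge0.
have mp : measurable_fun [set: R] p.
  by apply: measurable_funX; exact: normr_measurable.
pose h := iter k T p.
have h0 x : 0 <= h x.
  by rewrite /h; elim: {+}k x => [//|i IHi]; exact: transfer_ge0.
have mh : measurable_fun [set: R] h.
  by rewrite /h; elim: {+}k => [//|i IHi]; exact: measurable_transfer.
have Jh : J = h 0.
  by apply: eq_iter_transfer_ge0 => // x x0; rewrite /p ger0_norm.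
have hJ (x : R) : x \in `[0, 1] -> J <= h x <= J + m%:R / N%:R ^+ k.
  rewrite in_itv /= => /andP[x0 x1].
  have /andP[hx1 hx2] : 0 <= h x - h 0 <= m%:R / N%:R ^+ k * (x - 0).
    apply: iter_transfer_lipschitz => // a b a0 ab b1.
    rewrite /p !ger0_norm ?(le_trans a0 ab)// subrXX.
    apply/andP; split.
      rewrite mulr_ge0 ?subr_ge0// sumr_ge0 // => i _.
      by rewrite mulr_ge0 ?exprn_ge0 // (le_trans a0 ab).
    rewrite mulrC ler_wpM2r ?subr_ge0 //.
    (* This cofactor of [b - a] in [b ^+ m - a ^+ m] has [m] terms, each at most 1 on [0, 1]; hence
       the Lipschitz constant [m]. *)
    have : \sum_(i < m) b ^+ (m.-1 - i) * a ^+ i <= \sum_(i < m) 1.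
      apply: ler_sum => i _.
      by rewrite mulr_ile1 ?exprn_ge0 ?exprn_ile1 ?(le_trans a0 ab)
        ?(le_trans ab b1).
    by rewrite sumr_const card_ord.
  rewrite Jh -subr_ge0 hx1 /= -lerBlDl (le_trans hx2) //.
  by rewrite subr0 ler_piMr // divr_ge0 ?exprn_ge0.
have unitI : measurable (`[0, 1]%classic : set (measurableTypeR R)).
  exact: measurable_itv.
(* Invariance holds for integrals over the whole line, so both sides pass through it. *)
have mom : (\int[mu]_(x in `[0%R, 1%R]) (x ^+ m)%:E =
    \int[mu]_(x in `[0%R, 1%R]) (h x)%:E)%E.
  rewrite -integral_unit_interval // -integral_iter_transfer //.
  rewrite integral_unit_interval //; apply: eq_integral => x.
  by rewrite inE /= in_itv /= => /andP[x0 _]; rewrite /p ger0_norm.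
have mhE : measurable_fun (`[0, 1]%classic : set (measurableTypeR R)) (EFin \o h).
  by apply/measurable_EFinP; exact: measurable_funS mh.
have lo : (J%:E <= \int[mu]_(x in `[0%R, 1%R]) (h x)%:E)%E.
  rewrite -[J%:E]mule1 -measure_unit_interval -(integral_cst mu unitI).
  apply: ge0_le_integral => //.
  - by move=> x _; rewrite lee_fin Jh.
  - by move=> x /hJ /andP[+ _]; rewrite lee_fin.
have hi : (\int[mu]_(x in `[0%R, 1%R]) (h x)%:E <= (J + m%:R / N%:R ^+ k)%:E)%E.
  rewrite -[leRHS]mule1 -measure_unit_interval -(integral_cst mu unitI).
  apply: ge0_le_integral => //.
  - by move=> x _; rewrite lee_fin.
  - by move=> x /hJ /andP[_]; rewrite lee_fin.
rewrite /moment /Rintegral mom.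
(* The finite bounds exclude infinite values, on which [fine] would return a default. *)
move: lo hi; case: (integral _ _ _) => [r| |] //=.
by rewrite !lee_fin => -> ->.
Qed.

End Invariance.
End Transfer.

(** * From the complex expansion to real coefficients *)

Section RealArguments.
Variable R : realType.

Lemma cvg_Re (u : nat -> R[i]) (l : R[i]) :
  u @ \oo --> (l : R[i]^o) ->
  (fun n => complex.Re (u n)) @ \oo --> complex.Re l.
Proof.
move=> /(@cvgrPdist_le R[i] R[i]^o nat \oo _ u) ul.
apply/cvgrPdist_le => e e0.
have : 0 < e%:C :> R[i] by rewrite ltcR.
move=> /ul; apply: filterS => n.
move=> /(le_trans (normc_ge_Re _)); rewrite lecR.
by case: l {ul} (u n) => [a b] [c d].
Qed.

Lemma cvg_Im (u : nat -> R[i]) (l : R[i]) :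
  u @ \oo --> (l : R[i]^o) ->
  (fun n => complex.Im (u n)) @ \oo --> complex.Im l.
Proof.
move=> /(@cvgrPdist_le R[i] R[i]^o nat \oo _ u) ul.
apply/cvgrPdist_le => e e0.
have : 0 < e%:C :> R[i] by rewrite ltcR.
move=> /ul; apply: filterS => n.
(* Multiplication by [i] keeps the modulus and turns the imaginary part into minus a real part, so
   the bound for real parts applies. *)
have -> : `|l - u n| = `|(l - u n) * 'i%C|.
  by rewrite normrM [X in _ = _ * X]normc_def /= expr0n expr1n add0r sqrtr1 mulr1.
move=> /(le_trans (normc_ge_Re _)); rewrite lecR ReiNIm normrN.
by case: l {ul} (u n) => [a b] [c d].
Qed.

Lemma cexp_real (t : R) : cexp t%:C = (expR t)%:C.
Proof. by rewrite /cexp /= cos0 sin0 mulr1. Qed.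

Lemma approximate_momentsE (N : nat) (alpha : 'rV[R]_N) (I : nat -> nat -> R[i])
    (m k : nat) :
  approximate_moments alpha I ->
  I m k = (iter k (transfer alpha) (fun x => x ^+ m) 0)%:C.
Proof.
move=> hI.
pose F (t : R) :=
  \prod_(1 <= r < k.+1) \sum_(n < N) alpha 0 n * expR (n%:R * t / N%:R ^+ r).
have hIr (t : R) :
    series (fun m => I m k * t%:C ^+ m / m`!%:R) @ \oo --> ((F t)%:C : R[i]^o).
  have := hI k t%:C.
  suff -> : \prod_(1 <= r < k.+1)
      \sum_(n < N) (alpha 0 n)%:C * cexp (n%:R * t%:C / N%:R ^+ r) =
      (F t)%:C by [].
  rewrite rmorph_prod; apply: eq_bigr => r _.
  rewrite rmorph_sum; apply: eq_bigr => n _.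
  have -> : n%:R * t%:C / N%:R ^+ r = (n%:R * t / N%:R ^+ r)%:C.
    by rewrite !rmorphM fmorphV rmorphXn !rmorph_nat.
  by rewrite cexp_real -rmorphM.
have termE (t : R) i : I i k * t%:C ^+ i / i`!%:R = I i k * (t ^+ i / i`!%:R)%:C.
  by rewrite -mulrA rmorphM fmorphV rmorphXn rmorph_nat.
have ReE t i : complex.Re (I i k * t%:C ^+ i / i`!%:R) =
    complex.Re (I i k) / i`!%:R * t ^+ i.
  by rewrite termE mulrAC -mulrA; case: (I i k) => a b /=; rewrite mulr0 subr0.
have ImE t i : complex.Im (I i k * t%:C ^+ i / i`!%:R) =
    complex.Im (I i k) / i`!%:R * t ^+ i.
  by rewrite termE mulrAC -mulrA; case: (I i k) => a b /=; rewrite mulr0 add0r.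
have fact_neq0 : m`!%:R != 0 :> R by rewrite pnatr_eq0 -lt0n fact_gt0.
(* At real [t] the product is the real number [F t]: the series of real parts has the same sum as
   [exp_moment_series], and the series of imaginary parts sums to 0. *)
apply/eqP; rewrite eq_complex /=; apply/andP; split; apply/eqP.
  apply: (mulIf (invr_neq0 fact_neq0)).
  apply: (@power_series_coef_unique R
    (fun i => complex.Re (I i k) / i`!%:R)
    (fun i => iter k (transfer alpha) (fun x => x ^+ i) 0 / i`!%:R) F) => t.
    rewrite (_ : series _ = fun n => complex.Re
        (series (fun i => I i k * t%:C ^+ i / i`!%:R) n)).
      exact: cvg_Re (hIr t).
    apply/funext => n; rewrite !seriesEord /= raddf_sum.
    by apply: eq_bigr => i _; exact/esym/ReE.
  exact: exp_moment_series.
apply: (mulIf (invr_neq0 fact_neq0)); rewrite mul0r.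
apply: (power_series_eq0 R (fun i => complex.Im (I i k) / i`!%:R)) => t.
rewrite (_ : series _ = fun n => complex.Im
    (series (fun i => I i k * t%:C ^+ i / i`!%:R) n)).
  exact: cvg_Im (hIr t).
apply/funext => n; rewrite !seriesEord /= raddf_sum.
by apply: eq_bigr => i _; exact/esym/ImE.
Qed.

End RealArguments.

Theorem theorem3p6 (R : realType) (N : nat) (hN : (2 <= N)%N)
    (alpha : 'rV[R]_N) (halpha : simplex alpha)
    (mu : probability (measurableTypeR R) R)
    (hmu : weighted_cantor_measure alpha mu)
    (I : nat -> nat -> R[i]) (hI : approximate_moments alpha I)
    (m k : nat) (hm : (2 <= m)%N) (hk : (1 <= k)%N) :
  `|(moment mu m)%:C - I m k| <=
    (expR 1 * m%:R * Num.sqrt (m%:R - 1) / N%:R ^+ k)%:C.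
Proof.
have N0 : (0 < N)%N := ltnW hN.
rewrite (approximate_momentsE _ _ _ _ m k hI) -rmorphB.
set J := iter _ _ _ _.
have /andP[lo hi] : J <= moment mu m <= J + m%:R / N%:R ^+ k.
  exact: moment_bounds.
(* The lower bound [lo] removes the modulus and leaves a real inequality. *)
rewrite ger0_norm ?ler0c ?subr_ge0 // lecR.
have bound : m%:R / N%:R ^+ k <=
    expR 1 * m%:R * Num.sqrt (m%:R - 1) / N%:R ^+ k :> R.
  rewrite ler_wpM2r ?invr_ge0 ?exprn_ge0 //.
  (* The extra factor is at least 1: [expR 1 >= 1 + 1], and [m - 1 >= 1] under the root. *)
  rewrite mulrAC ler_peMl // -[leLHS]mulr1 ler_pM //.
    by rewrite (le_trans _ (expR_ge1Dx 1)) // lerDl.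
  rewrite -[leLHS]sqrtr1 ler_wsqrtr // lerBrDr.
  by rewrite (ler_nat R 2).
by rewrite (le_trans _ bound) // lerBlDl.
Qed.
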